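(* Let $(X,\rho)$ be a connected metric space which is cube-decomposable, let $d>0$, and let $\mu$ be a finite positive Borel measure on $X$ that is Ahlfors--David regular of dimension $d$. Let $C^*>0$ be a constant, depending only on $(X,\rho,\mu)$, such that for all positive $\lambda_1,\dots,\lambda_n$ with $\sum_{j=1}^n\lambda_j=\mu(X)$ there exist measurable $X_1,\dots,X_n\subset X$ with $X=\bigsqcup_{j=1}^nX_j$ (disjoint union), $\mu(X_j)=\lambda_j$, and each $X_j$ contained in a ball of radius $C^*\lambda_j^{1/d}$ (such a constant exists under these hypotheses). Then, for all such $\lambda_1,\dots,\lambda_n$ and such $X_1,\dots,X_n$, one has $\operatorname{diam}X_j\asymp_X\lambda_j^{1/d}$; that is, there is a constant $A\ge 1$, depending only on $X$ (with its metric and measure), such that $$A^{-1}\lambda_j^{1/d}\le\operatorname{diam}X_j\le A\,\lambda_j^{1/d}\qquad (j=1,\dots,n).$$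
   Context: $B(x,R)$ denotes the open ball with centre $x$ and radius $R$. Ahlfors--David regular of dimension $d$: there is a constant $A_0\ge 1$ such that $A_0^{-1}r^d\le\mu(B(x,r))\le A_0 r^d$ for all $x\in X$ and all $0<r\le\operatorname{diam}X$. A family of dyadic cubes of a metric space $(X,\rho)$ is a collection of subsets $Q_\alpha^k\subset X$, $k\in\mathbb{N}_0$, $\alpha\in I_k$ ($I_k$ index sets), for which there exist a ball constant $C>0$ and a scaling value $\delta\in(0,1)$ such that: (a) $X=\bigsqcup_{\alpha\in I_k}Q_\alpha^k$ for each $k\in\mathbb{N}_0$; (b) for each $l\ge k$, $\alpha\in I_l$, $\beta\in I_k$, either $Q_\alpha^l\subset Q_\beta^k$ or $Q_\alpha^l\cap Q_\beta^k=\emptyset$; (c) for each $Q_\alpha^k$ there is a point $x_\alpha^k\in Q_\alpha^k$ with $B(x_\alpha^k,C^{-1}\delta^k)\subseteq Q_\alpha^k\subseteq B(x_\alpha^k,C\delta^k)$. The family is connected if, in addition, (d) each $Q_\alpha^k$ is a connected subset of $X$. $X$ is cube-decomposable if it has a connected family of dyadic cubes. *)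

(* Defs.v *)
From HB Require Import structures.
From mathcomp Require Import all_boot all_order all_algebra.
From mathcomp Require Import all_classical all_reals all_analysis.

Set Implicit Arguments.
Unset Strict Implicit.
Unset Printing Implicit Defensive.

Import Order.TTheory GRing.Theory Num.Theory.

Local Open Scope classical_set_scope.
Local Open Scope ring_scope.

(* The base point is there only because [measurableType] extends
   [pointedType]: it amounts to requiring the space to be nonempty. *)
#[short(type="pmetricType")]
HB.structure Definition PointedMetric (K : numDomainType) :=
  {M of Pointed M & Metric K M}.

(* [g_sigma_algebraType] is an alias of the space without its topology;
   subsets of [borelType X] and of [X] are convertible. *)
Notation borelType X := (g_sigma_algebraType (@open X)).

(* The maximum with 0 gives [diam set0 = 0]; the bare supremum is -oo. *)
Definition diam (R : realType) (X : metricType R) (A : set X) : \bar R :=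
  maxe 0%E (ereal_sup [set (mdist xy.1 xy.2)%:E | xy in A `*` A]).

Definition ahlfors_david_regular (R : realType) (X : pmetricType R)
    (mu : set (borelType X) -> \bar R) (d : R) : Prop :=
  exists2 A0 : R, 1 <= A0 &
    forall (x : X) (r : R), 0 < r -> (r%:E <= diam [set: X])%E ->
      ((A0^-1 * r `^ d)%:E <= mu (ball x r))%E /\
      (mu (ball x r) <= (A0 * r `^ d)%:E)%E.

Definition dyadic_cubes (R : realType) (X : metricType R)
    (I : nat -> Type) (Q : forall k, I k -> set X) : Prop :=
  exists C delta : R, [/\ 0 < C,
    0 < delta < 1,
    forall k, \bigcup_a Q k a = [set: X] /\ trivIset [set: I k] (Q k),
    forall l k (a : I l) (b : I k), (k <= l)%N ->
      Q l a `<=` Q k b \/ Q l a `&` Q k b = set0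
  & forall k (a : I k), exists x : X, [/\ Q k a x,
      ball x (C^-1 * delta ^+ k) `<=` Q k a
    & Q k a `<=` ball x (C * delta ^+ k)]].

Definition connected_dyadic_cubes (R : realType) (X : metricType R)
    (I : nat -> Type) (Q : forall k, I k -> set X) : Prop :=
  dyadic_cubes Q /\ forall k (a : I k), connected (Q k a).

Definition cube_decomposable (R : realType) (X : metricType R) : Prop :=
  exists (I : nat -> Type) (Q : forall k, I k -> set X),
    connected_dyadic_cubes Q.

Definition admissible_weights (R : realType) (X : pmetricType R)
    (mu : set (borelType X) -> \bar R) (n : nat) (lambda : 'I_n -> R) : Prop :=
  (forall j, 0 < lambda j) /\ (\sum_(j < n) lambda j)%:E = mu [set: X].

Definition ball_partition (R : realType) (X : pmetricType R)
    (mu : set (borelType X) -> \bar R) (d Cstar : R)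
    (n : nat) (lambda : 'I_n -> R) (P : 'I_n -> set X) : Prop :=
  [/\ forall j, measurable (P j : set (borelType X)),
      \bigcup_j P j = [set: X],
      trivIset [set: 'I_n] P,
      forall j, mu (P j) = (lambda j)%:E
    & forall j, exists x : X, P j `<=` ball x (Cstar * lambda j `^ d^-1)].

(* Main.v *)
(* The upper bound is the triangle inequality inside the ball containing [P j].
   For the lower bound, [P j] lies in the ball of any radius r > diam (P j)
   about any of its points, so regularity gives lambda j <= A0 r^d as long as
   r <= diam X; letting r tend to diam (P j) settles small diameters.  Diameters
   above a fixed M <= diam X are settled by lambda j <= mu X. *)

Require Import Defs.
From HB Require Import structures.
From mathcomp Require Import all_boot all_order all_algebra.
From mathcomp Require Import all_classical all_reals all_analysis.
From mathcomp Require Import lra.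

Import Order.TTheory GRing.Theory Num.Theory.

Local Open Scope classical_set_scope.
Local Open Scope ring_scope.

Lemma mdist_le_diam (R : realType) (X : metricType R) (A : set X) (x y : X) :
  A x -> A y -> ((mdist x y)%:E <= diam A)%E.
Proof.
move=> Ax Ay; rewrite /diam le_max; apply/orP; right.
by apply: ereal_sup_ubound; exists (x, y).
Qed.

Lemma diam_ge0 (R : realType) (X : metricType R) (A : set X) : (0 <= diam A)%E.
Proof. by rewrite /diam le_max lexx. Qed.

(** The hypothesis [0 <= r] is for empty [A]: a ball of negative radius is empty, and its diameter
    is 0 by convention. *)
Lemma diam_sub_ball (R : realType) (X : metricType R) (A : set X) (x : X) (r : R) :
  0 <= r -> A `<=` ball x r -> (diam A <= (2 * r)%:E)%E.
Proof.
move=> r0 Ar; rewrite /diam ge_max lee_fin mulr_ge0//=.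
apply: ge_ereal_sup => _ [[y z] [/= /Ar Ay /Ar Az] <-].
move: Ay Az; rewrite !ballEmdist/= lee_fin => xy xz.
rewrite (le_trans (metric_triangle y x z))// metric_sym mulr2n mulrDl !mul1r.
by rewrite lerD// ltW.
Qed.

Lemma sub_ball_diam (R : realType) (X : metricType R) (A : set X) (x : X) (r : R) :
  A x -> (diam A < r%:E)%E -> A `<=` ball x r.
Proof.
move=> Ax Ar y Ay; rewrite ballEmdist/= -lte_fin.
exact: le_lt_trans (mdist_le_diam _ _ _ _ _ Ax Ay) Ar.
Qed.

Lemma open_ball_metric (R : realType) (X : metricType R) (x : X) (r : R) :
  open (ball x r).
Proof.
rewrite openE => y; rewrite ballEmdist/= => xy.
apply/nbhs_ballP; exists (r - mdist x y); first by rewrite /= subr_gt0.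
move=> z; rewrite !ballEmdist/= ltrBrDl => yz.
exact: le_lt_trans (metric_triangle x y z) yz.
Qed.

Lemma measurable_ball_borel (R : realType) (X : pmetricType R) (x : X) (r : R) :
  measurable (ball x r : set (borelType X)).
Proof. by apply: sub_sigma_algebra; exact: open_ball_metric. Qed.

Lemma powR_root_le (R : realType) (a d l r : R) : 0 < d -> 0 <= a -> 0 <= r ->
  0 <= l -> l <= a * r `^ d -> l `^ d^-1 <= a `^ d^-1 * r.
Proof.
move=> d0 a0 r0 l0 lar.
have -> : a `^ d^-1 * r = (a * r `^ d) `^ d^-1.
  by rewrite powRM ?powR_ge0// -powRrM divff ?gt_eqF// powRr1.
apply: ge0_ler_powR => //; rewrite ?nnegrE ?invr_ge0 ?mulr_ge0 ?powR_ge0//.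
exact: ltW.
Qed.

(** The strict inequality [D < M] leaves radii [r] with [D < r <= M], where regularity applies. The
    case [D = 0] is allowed; as [0 < l], the conclusion then rules it out. *)
Lemma root_measure_le_diam (R : realType) (X : pmetricType R)
    (mu : {finite_measure set (borelType X) -> \bar R}) (d A0 M l D : R)
    (P : set X) :
  0 < d -> 0 <= A0 ->
  (forall (x : X) (r : R), 0 < r -> (r%:E <= diam [set: X])%E ->
     (mu (ball x r) <= (A0 * r `^ d)%:E)%E) ->
  (M%:E <= diam [set: X])%E -> measurable (P : set (borelType X)) ->
  mu P = l%:E -> 0 < l -> diam P = D%:E -> D < M ->
  l `^ d^-1 <= A0 `^ d^-1 * D.
Proof.
move=> d0 A00 reg MX mP muP l0 diamP DM.
have [x Px] : P !=set0.
  apply/set0P/eqP => P0; move: muP; rewrite P0 measure0 => -[] l00.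
  by rewrite -l00 ltxx in l0.
have D0 : 0 <= D by rewrite -lee_fin -diamP diam_ge0.
(* Balls are open, so [P] need not lie in a ball of radius [D] itself; this is why a limit in [r]
   follows. *)
have small r : D < r -> r <= M -> l `^ d^-1 <= A0 `^ d^-1 * r.
  move=> Dr rM; have r0 := le_lt_trans D0 Dr.
  apply: powR_root_le => //; try exact: ltW.
  rewrite -lee_fin -muP (le_trans _ (reg x r r0 _))//; last first.
    by rewrite (le_trans _ MX)// lee_fin.
  apply: le_measure; rewrite ?inE//; first exact: measurable_ball_borel.
  by apply: sub_ball_diam => //; rewrite diamP lte_fin.
have pow0 : 0 <= A0 `^ d^-1 by exact: powR_ge0.
(* The limit is taken after division by this constant, so the value 0 is treated apart, with
   [r = M]. *)
move: pow0; rewrite le_eqVlt => /predU1P[B0|B0].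
  by rewrite -B0 mul0r (le_trans (small M DM (lexx _)))// -B0 mul0r.
rewrite -ler_pdivrMl//; apply/ler_addgt0Pr => e e0; rewrite ler_pdivrMl//.
(* If [D + e] exceeds [M], the radius [M] itself is used and gives a stronger bound. *)
have [eM|Me] := leP (D + e) M; first by apply: small eM; rewrite ltrDl.
by rewrite (le_trans (small M DM (lexx _)))// ler_pM2l// ltW.
Qed.

Theorem corollary3p2 (R : realType) (X : pmetricType R)
    (* fails for a one-point space of positive mass, where diam X = 0 *)
    (hX2 : exists x y : X, x <> y)
    (hconn : connected [set: X])
    (hcubes : cube_decomposable X)
    (d : R) (hd : 0 < d)
    (mu : {finite_measure set (borelType X) -> \bar R})
    (hreg : ahlfors_david_regular mu d)
    (Cstar : R) (hCstar : 0 < Cstar)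
    (hpart : forall (n : nat) (lambda : 'I_n -> R),
      admissible_weights mu lambda ->
      exists P : 'I_n -> set X, ball_partition mu d Cstar lambda P) :
  exists2 A : R, 1 <= A &
    forall (n : nat) (lambda : 'I_n -> R) (P : 'I_n -> set X),
      admissible_weights mu lambda ->
      ball_partition mu d Cstar lambda P ->
      forall j : 'I_n,
        ((A^-1 * lambda j `^ d^-1)%:E <= diam (P j))%E /\
        (diam (P j) <= (A * lambda j `^ d^-1)%:E)%E.
Proof.
case: hreg => A0 A01 reg; case: hX2 => x0 [y0 /eqP xy0].
(* A positive real threshold below the extended real [diam [set: X]], chosen from [X] alone. *)
pose M := mdist x0 y0; have M0 : 0 < M by rewrite mdist_gt0.
have MX : (M%:E <= diam [set: X])%E by exact: mdist_le_diam.
pose m := fine (mu [set: X]).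
have muX : mu [set: X] = m%:E by rewrite fineK// fin_num_measure.
(* Chosen so that [K * M] is the [d]-th root of the total mass, which bounds that of every
   weight. *)
pose K := m `^ d^-1 / M.
have K0 : 0 <= K by rewrite divr_ge0 ?powR_ge0// ltW.
have B0 : 0 <= A0 `^ d^-1 by exact: powR_ge0.
have C0 : 0 <= 2 * Cstar by rewrite mulr_ge0// ltW.
(* All summands are nonnegative, so [A] dominates each: [2 * Cstar] serves the upper bound, the root
   of [A0] the diameters below [M], and [K] the others. *)
pose A := 1 + 2 * Cstar + A0 `^ d^-1 + K.
have A1 : 1 <= A by rewrite /A; lra.
have A_gt0 : 0 < A by exact: lt_le_trans A1.
exists A => // n lambda P [lambda0 _] [mP _ _ muP Pball] j.
have lj := lambda0 j; have s0 := powR_ge0 (lambda j) d^-1.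
have [x Px] := Pball j.
have up : (diam (P j) <= (2 * (Cstar * lambda j `^ d^-1))%:E)%E.
  by apply: diam_sub_ball _ Px; rewrite mulr_ge0// ltW.
have [D diamP] : exists D, diam (P j) = D%:E.
  exists (fine (diam (P j))); rewrite fineK// fin_numElt.
  by rewrite (lt_le_trans _ (diam_ge0 _ _ _)) ?ltNyr// (le_lt_trans up) ?ltry.
have D0 : 0 <= D by rewrite -lee_fin -diamP diam_ge0.
move: up; rewrite diamP !lee_fin => up; split; last first.
  by rewrite (le_trans up)// mulrA ler_wpM2r// /A; lra.
rewrite ler_pdivrMl//; have [MD|DM] := leP M D.
  have lK : lambda j `^ d^-1 <= K * M.
    rewrite divfK ?gt_eqF//; apply: ge0_ler_powR;
      rewrite ?nnegrE ?invr_ge0 ?(ltW hd) ?(ltW lj)//.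
      by rewrite fine_ge0.
    rewrite -lee_fin -muP -muX; apply: le_measure; rewrite ?inE//; exact: mP.
  rewrite (le_trans lK)// (@le_trans _ _ (K * D))//; first exact: ler_wpM2l.
  by rewrite ler_wpM2r// /A; lra.
rewrite (@le_trans _ _ (A0 `^ d^-1 * D))//; last first.
  by rewrite ler_wpM2r// /A; lra.
apply: (@root_measure_le_diam _ _ mu d A0 M _ _ (P j)) => //; first lra.
by move=> y r r0 rX; have [] := reg y r r0 rX.
Qed.
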